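(* Let $L$ be a frame, let $(P;e)$ be a fuzzy dcpo, let $H_P$ be the set of all monotone maps $(P;e)\to(P;e)$ with the $L$-order $\overline e(f,g)=\bigwedge_{x\in P}e(f(x),g(x))$, and let $S:H_P\to L$ be defined by $S(\alpha)=\overline e(Id_P,\alpha)$ for all $\alpha\in H_P$. Then $\sqcup S$ exists and belongs to $H_P$. Moreover, $$S(\alpha)\wedge S(\sqcup S)\le\overline e(\alpha\circ\sqcup S,\sqcup S)\wedge\overline e(\sqcup S,\alpha\circ\sqcup S)\quad\text{for all }\alpha\in H_P.$$
   Context: A frame is a complete lattice $L$ (with bottom $0$, top $1$) satisfying $a\wedge\bigvee S=\bigvee_{s\in S}(a\wedge s)$ for all $a\in L$, $S\subseteq L$; its relative pseudocomplement is $a\to b=\bigvee\{x\in L\mid a\wedge x\le b\}$. $L^X$ is the set of all maps $X\to L$. An $L$-ordered set is a pair $(X;e)$ with $X$ a set and $e:X\times X\to L$ a map such that for all $x,y,z\in X$: (E1) $e(x,x)=1$; (E2) $e(x,y)\wedge e(y,z)\le e(x,z)$; (E3) $e(x,y)=e(y,x)=1$ implies $x=y$. For $S\in L^X$, an element $x_0\in X$ is the join of $S$, written $x_0=\sqcup S$, if for all $x\in X$: $S(x)\le e(x,x_0)$ and $\bigwedge_{y\in X}(S(y)\to e(y,x))\le e(x_0,x)$. Joins are unique when they exist. Here $\sqcup S$ is the join of $S$ in the $L$-ordered set $(H_P;\overline e)$. $D\in L^X$ is a fuzzy directed subset of $(X;e)$ if (FD1) $\bigvee_{x\in X}D(x)=1$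 and (FD2) for all $x,y\in X$, $D(x)\wedge D(y)\le\bigvee_{z\in X}(D(z)\wedge e(x,z)\wedge e(y,z))$. An $L$-ordered set is a fuzzy dcpo if every fuzzy directed subset of it has a join. A map $f:(P;e)\to(P;e)$ is monotone if $e(x,y)\le e(f(x),f(y))$ for all $x,y\in P$. $Id_P$ is the identity map of $P$. *)

(* Defs.v *)
From HB Require Import structures.
From mathcomp Require Import all_boot all_order.
From mathcomp Require Import boolp classical_sets.

Set Implicit Arguments.
Unset Strict Implicit.
Unset Printing Implicit Defensive.

Import Order.TTheory.
Local Open Scope classical_set_scope.
Local Open Scope order_scope.

HB.mixin Record TBLattice_isFrame d L of Order.TBLattice d L := {
  fsup : set L -> L;
  fsupP : forall A : set L, supremums A (fsup A);
  meet_fsup : forall (a : L) (A : set L),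
    a `&` fsup A = fsup [set a `&` s | s in A]
}.

#[short(type="frameType")]
HB.structure Definition Frame d :=
  { L of TBLattice_isFrame d L & Order.TBLattice d L }.

Section FrameOps.
Context {d : Order.disp_t} {L : frameType d}.

Definition finf (A : set L) : L := fsup (lbound A).

Definition fimp (a b : L) : L := fsup [set x : L | a `&` x <= b].

Lemma finfP (A : set L) : infimums A (finf A).
Proof.
have [ubs lbs] := fsupP (lbound A).
split; last by move=> b; exact: ubs.
by move=> a Aa; apply: lbs => b; apply.
Qed.

Lemma le_fimp (a b c : L) : (c <= fimp a b) = (a `&` c <= b).
Proof.
have [ubs lbs] := fsupP [set x : L | a `&` x <= b].
apply/idP/idP => [h|h]; last exact: ubs.
apply: (le_trans (leI2 (lexx a) h)).
rewrite /fimp meet_fsup.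
by have [_] := fsupP [set a `&` s | s in [set x | a `&` x <= b]];
  apply => _ [x + <-].
Qed.

End FrameOps.

Notation "\fsup_ x F" := (fsup (range (fun x => F)))
  (at level 41, x name, F at level 41, format "\fsup_ x  F") : order_scope.
Notation "\finf_ x F" := (finf (range (fun x => F)))
  (at level 41, x name, F at level 41, format "\finf_ x  F") : order_scope.
Notation "a ~> b" := (fimp a b) (at level 55, right associativity) : order_scope.

Section FrameFamilies.
Context {d : Order.disp_t} {L : frameType d}.

Lemma finf_le (X : Type) (F : X -> L) (x : X) : \finf_ y F y <= F x.
Proof. by have [h _] := finfP (range F); apply: h; exists x. Qed.

Lemma le_finf (X : Type) (F : X -> L) (a : L) :
  (forall x, a <= F x) -> a <= \finf_ y F y.
Proof. by move=> h; have [_ +] := finfP (range F); apply => _ [x _ <-]. Qed.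

End FrameFamilies.

Record lOrderedSet d (L : frameType d) := LOrderedSet {
  lcarrier :> Type;
  lord : lcarrier -> lcarrier -> L;
  lord_refl : forall x, lord x x = \top;
  lord_trans : forall x y z, lord x y `&` lord y z <= lord x z;
  lord_anti : forall x y, lord x y = \top -> lord y x = \top -> x = y
}.

Section LOrdered.
Context {d : Order.disp_t} {L : frameType d}.

Definition is_join (X : lOrderedSet L) (S : X -> L) (x0 : X) : Prop :=
  forall x : X,
    S x <= lord x x0 /\ \finf_ y (S y ~> lord y x) <= lord x0 x.

Lemma is_join_unique (X : lOrderedSet L) (S : X -> L) (x0 x1 : X) :
  is_join S x0 -> is_join S x1 -> x0 = x1.
Proof.
have le1 (a b : X) : is_join S a -> is_join S b -> lord a b = \top.
  move=> ja jb; apply/eqP; rewrite -le1x.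
  apply: le_trans (proj2 (ja b)).
  by apply: le_finf => y; rewrite le_fimp meetx1; exact: (proj1 (jb y)).
by move=> j0 j1; apply: lord_anti; exact: le1.
Qed.

Definition fuzzy_directed (X : lOrderedSet L) (D : X -> L) : Prop :=
  \fsup_ x D x = \top /\
  forall x y : X,
    D x `&` D y <= \fsup_ z (D z `&` lord x z `&` lord y z).

Definition fuzzy_dcpo (X : lOrderedSet L) : Prop :=
  forall D : X -> L, fuzzy_directed D -> exists x0 : X, is_join D x0.

Definition l_monotone (P : lOrderedSet L) (f : P -> P) : Prop :=
  forall x y : P, lord x y <= lord (f x) (f y).

Record monoMap (P : lOrderedSet L) := MonoMap {
  mono_fun :> P -> P;
  mono_funP : l_monotone mono_fun
}.

Lemma monoMap_eq (P : lOrderedSet L) (f g : monoMap P) : f =1 g -> f = g.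
Proof.
case: f g => f fP [g gP] /= /funext fg; rewrite fg in fP *.
by rewrite (Prop_irrelevance fP gP).
Qed.

Lemma l_monotone_id (P : lOrderedSet L) : l_monotone (@id P).
Proof. by move=> x y. Qed.

Definition mono_id (P : lOrderedSet L) : monoMap P :=
  MonoMap (@l_monotone_id P).

Lemma l_monotone_comp (P : lOrderedSet L) (f g : monoMap P) :
  l_monotone (f \o g).
Proof. by move=> x y; apply: le_trans (mono_funP g x y) (mono_funP f _ _). Qed.

Definition mono_comp (P : lOrderedSet L) (f g : monoMap P) : monoMap P :=
  MonoMap (l_monotone_comp f g).

Section MonoMapOrder.
Variable P : lOrderedSet L.

Definition mono_lord (f g : monoMap P) : L := \finf_ x lord (f x) (g x).

Lemma mono_lord_refl f : mono_lord f f = \top.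
Proof.
by apply/eqP; rewrite -le1x; apply: le_finf => x; rewrite lord_refl.
Qed.

Lemma mono_lord_trans f g h : mono_lord f g `&` mono_lord g h <= mono_lord f h.
Proof.
apply: le_finf => x; apply: le_trans (lord_trans (f x) (g x) (h x)).
exact: leI2 (finf_le _ x) (finf_le _ x).
Qed.

Lemma mono_lord_anti f g :
  mono_lord f g = \top -> mono_lord g f = \top -> f = g.
Proof.
move=> fg gf; apply: monoMap_eq => x.
by apply: lord_anti; apply/eqP; rewrite -le1x;
  [rewrite -fg|rewrite -gf]; exact: (finf_le _ x).
Qed.

Definition HP : lOrderedSet L :=
  LOrderedSet mono_lord_refl mono_lord_trans mono_lord_anti.

Definition above_id (alpha : HP) : L := @lord d L HP (mono_id P) alpha.

End MonoMapOrder.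
End LOrdered.

(* Main.v *)
(** The map [above_id] is a fuzzy directed subset of [HP P]: it contains the
    identity to degree 1, and [mono_comp f g] bounds both [f] and [g] to degree
    at least [above_id f `&` above_id g].  Joins of fuzzy directed families of
    monotone maps exist and are computed pointwise, as joins of the images under
    the evaluation maps, so the join [s] exists.  Finally
    [above_id alpha `&` above_id s] lies below [above_id (mono_comp alpha s)],
    hence below the degree of [mono_comp alpha s] under its bound [s]; the
    converse degree only needs [above_id alpha]. *)
Require Import Defs.
From HB Require Import structures.
From mathcomp Require Import all_boot all_order.
From mathcomp Require Import boolp classical_sets.
Set Implicit Arguments.
Unset Strict Implicit.
Unset Printing Implicit Defensive.
Import Order.TTheory.
Local Open Scope order_scope.

Section FrameSups.
Context {d : Order.disp_t} {L : frameType d}.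

Lemma fsup_ge (X : Type) (F : X -> L) (x : X) (a : L) :
  a <= F x -> a <= \fsup_ y F y.
Proof.
by move=> aF; apply: (le_trans aF); have [h _] := fsupP (range F); apply: h; exists x.
Qed.

Lemma meet_fsup_le (X : Type) (F : X -> L) (a b : L) :
  (forall x, a `&` F x <= b) -> a `&` \fsup_ y F y <= b.
Proof.
move=> h; rewrite -le_fimp; have [_] := fsupP (range F).
by apply=> _ [x _ <-]; rewrite le_fimp.
Qed.

End FrameSups.

Section Joins.
Context {d : Order.disp_t} {L : frameType d}.

Lemma le_lord_trans (X : lOrderedSet L) (y x z : X) (t : L) :
  t <= lord x y -> t <= lord y z -> t <= lord x z.
Proof. by move=> xy yz; apply: le_trans (lord_trans x y z); rewrite lexI xy. Qed.

(** By the adjunction [le_fimp], the infimum of implications is traded for an arbitrary degree [t],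
    so later arguments never meet [fimp]. *)
Lemma is_joinP (X : lOrderedSet L) (S : X -> L) (x0 : X) :
  is_join S x0 <->
  (forall x, S x <= lord x x0) /\
  (forall x t, (forall y, S y `&` t <= lord y x) -> t <= lord x0 x).
Proof.
split=> [j|[ub lub] x]; first split=> [x|x t h].
- by have [] := j x.
- have [_] := j x; apply: le_trans.
  by apply: le_finf => y; rewrite le_fimp.
- split=> //; apply: lub => y; rewrite -le_fimp.
  exact: (finf_le (fun y => S y ~> lord y x)).
Qed.

(* The down-closed image: it has the same upper bounds as the plain image. *)
Definition down_image (X Y : lOrderedSet L) (phi : X -> Y) (D : X -> L) (y : Y) : L :=
  \fsup_ x (D x `&` lord y (phi x)).

Lemma le_down_image (X Y : lOrderedSet L) (phi : X -> Y) (D : X -> L) (x : X) :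
  D x <= down_image phi D (phi x).
Proof. by apply: (@fsup_ge _ _ _ _ x); rewrite lord_refl meetx1. Qed.

Lemma fuzzy_directed_down_image (X Y : lOrderedSet L) (phi : X -> Y) (D : X -> L) :
  (forall x x', lord x x' <= lord (phi x) (phi x')) ->
  fuzzy_directed D -> fuzzy_directed (down_image phi D).
Proof.
move=> phi_mono [D1 D2]; split=> [|y z].
  (* The meet with [\top] only gives the goal the shape expected by [meet_fsup_le]. *)
  apply/eqP; rewrite -le1x -D1 -[leLHS]meet1x; apply: meet_fsup_le => x.
  by rewrite meet1x; apply: (@fsup_ge _ _ _ _ (phi x)); exact: le_down_image.
apply: meet_fsup_le => g; rewrite meetC; apply: meet_fsup_le => f.
set t := _ `&` _.
have tD : t <= \fsup_ h (D h `&` lord f h `&` lord g h).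
  by apply: le_trans (D2 f g); rewrite meetC; apply: leI2; exact: leIl.
(* One copy of [t] keeps the degrees of [y] under [phi f] and of [z] under [phi g]; the other is
   spent on a common bound [h] of [f] and [g], and [phi h] is the witness. *)
rewrite -[t]meetxx; apply: le_trans (leI2 (lexx t) tD) _.
apply: meet_fsup_le => h; apply: (@fsup_ge _ _ _ _ (phi h)).
set u := leLHS.
have := lexx u; rewrite {2}/u !lexI => /andP[/andP[/andP[_ uz] /andP[_ uy]]].
move=> /andP[/andP[uD uf] ug].
rewrite (le_trans uD (le_down_image _ _ _)) /=.
apply/andP; split.
- exact: le_lord_trans uy (le_trans uf (phi_mono _ _)).
- exact: le_lord_trans uz (le_trans ug (phi_mono _ _)).
Qed.

(** Whatever lies in the down-closure lies under some [phi x], so by transitivity it suffices to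
    bound the points [phi x]. *)
Lemma is_join_down_image (X Y : lOrderedSet L) (phi : X -> Y) (D : X -> L) (y0 : Y) :
  is_join (down_image phi D) y0 ->
  (forall x, D x <= lord (phi x) y0) /\
  (forall y t, (forall x, D x `&` t <= lord (phi x) y) -> t <= lord y0 y).
Proof.
move=> /is_joinP[ub lub]; split=> [x|y t h].
  exact: le_trans (le_down_image _ _ _) (ub _).
apply: lub => z; rewrite meetC; apply: meet_fsup_le => x.
set u := leLHS.
have := lexx u; rewrite {2}/u !lexI => /andP[ut /andP[uD uz]].
by apply: (le_lord_trans uz); apply: le_trans (h x); rewrite lexI uD.
Qed.

End Joins.

Section MonotoneMaps.
Context {d : Order.disp_t} {L : frameType d} (P : lOrderedSet L).

Lemma lord_HP_le (f g : HP P) (x : P) : lord f g <= lord (f x) (g x).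
Proof. exact: (finf_le (fun x => lord (f x) (g x))). Qed.

Lemma above_id_le (f : HP P) (x : P) : above_id f <= lord x (f x).
Proof. exact: (lord_HP_le (mono_id P)). Qed.

(** Pointwise chain: [x] is below [g x], which is below [f (g x)]. *)
Lemma above_id_comp (f g : HP P) :
  above_id f `&` above_id g <= above_id (mono_comp f g : HP P).
Proof.
apply: le_finf => x /=; apply: (@le_lord_trans _ _ _ (g x)).
- exact: leIxr (above_id_le g x).
- exact: leIxl (above_id_le f (g x)).
Qed.

Lemma above_id_lord_compl (f g : HP P) :
  above_id f <= lord g (mono_comp f g : HP P).
Proof. by apply: le_finf => x; exact: above_id_le. Qed.

(** Here monotonicity of [f] is applied to [x] below [g x]. *)
Lemma above_id_lord_compr (f g : HP P) :
  above_id g <= lord f (mono_comp f g : HP P).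
Proof.
by apply: le_finf => x; exact: le_trans (above_id_le g x) (mono_funP f _ _).
Qed.

Lemma fuzzy_directed_above_id : fuzzy_directed (@above_id d L P).
Proof.
split=> [|f g].
  apply/eqP; rewrite -le1x; apply: (@fsup_ge _ _ _ _ (mono_id P)).
  by rewrite /above_id lord_refl.
apply: (@fsup_ge _ _ _ _ (mono_comp f g)).
by rewrite !lexI above_id_comp leIxr ?above_id_lord_compr ?leIxl ?above_id_lord_compl.
Qed.

Lemma fuzzy_dcpo_HP : fuzzy_dcpo P -> fuzzy_dcpo (HP P).
Proof.
move=> dcpoP D Ddir.
pose ev (x : P) (f : HP P) : P := f x.
have /choice[s s_join] x : exists x0, is_join (down_image (ev x) D) x0.
  apply/dcpoP/fuzzy_directed_down_image => // f g; exact: lord_HP_le.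
have s_ub x f : D f <= lord (f x) (s x).
  by have [ub _] := is_join_down_image (s_join x); exact: ub.
have s_lub x y t : (forall f, D f `&` t <= lord (ev x f) y) -> t <= lord (s x) y.
  by have [_ lub] := is_join_down_image (s_join x); exact: lub.
have s_mono : l_monotone s.
  (* With [t] equal to [lord x y]: [f x] is below [f y] to degree [t], and [f y] is below [s y] to
     degree [D f]. *)
  move=> x y; apply: s_lub => f; apply: (@le_lord_trans _ _ _ (f y)).
  - exact: leIxr (mono_funP f x y).
  - exact: leIxl (s_ub y f).
exists (MonoMap s_mono); apply/is_joinP; split=> [f|g t h].
  by apply: le_finf => x; exact: s_ub.
apply: le_finf => x; apply: s_lub => f.
exact: le_trans (h f) (lord_HP_le f g x).
Qed.

End MonotoneMaps.

Theorem theorem4p2 (d : Order.disp_t) (L : frameType d) (P : lOrderedSet L)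
    (dcpoP : fuzzy_dcpo P) :
  exists supS : HP P,
    is_join (@above_id d L P) supS /\
    forall alpha : HP P,
      above_id alpha `&` above_id supS <=
        lord (mono_comp alpha supS : HP P) supS `&`
        lord supS (mono_comp alpha supS : HP P).
Proof.
have [s s_join] := fuzzy_dcpo_HP dcpoP (@fuzzy_directed_above_id d L P).
exists s; split=> // alpha.
rewrite lexI; apply/andP; split; last exact: leIxl (above_id_lord_compl _ _).
have [ub _] := s_join (mono_comp alpha s).
exact: le_trans (above_id_comp alpha s) ub.
Qed.
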